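(* Let $\alpha$ be a real constant. The matrix condition $$\underline{\mathcal{P}}\,\mathcal{M}+\mathcal{M}^T\underline{\mathcal{P}}+E^T\,\underline{P}\,\big(\underline{N^T\dot X}\big)E-\alpha\,\underline{\mathcal{P}}\le 0$$ on the system matrix $\mathcal{M}=\mathcal{D}+\mathcal{L}_{\boldsymbol\delta}\mathcal{B}$ is equivalent to the transformed system matrix $\hat{\mathcal{M}}=\hat{\mathcal{D}}+\underline{\sqrt{\mathcal{J}}}\,\mathcal{L}_{\boldsymbol\delta}\hat{\mathcal{B}}$ satisfying $$\underline{\hat{\mathcal{P}}}\,\hat{\mathcal{M}}+\hat{\mathcal{M}}^T\underline{\hat{\mathcal{P}}}-\alpha\,\underline{\hat{\mathcal{P}}}\le 0,$$ thus guaranteeing that the real part of the spectrum of $\hat{\mathcal{M}}$ is non-positive if $\alpha\le 0$.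
   Context: Notation: for a vector $\boldsymbol v$, $\underline{\boldsymbol v}$ denotes the diagonal matrix $\mathrm{Diag}(\boldsymbol v)$; $\le 0$ for a symmetric matrix means negative semidefinite. Square roots of vectors are entrywise. All quantities may depend on $t$ (and $\mathcal{D},\mathcal{B}$ possibly on the numerical solution $\boldsymbol U$), and the matrix conditions are read at the same given time (and state) on both sides. Mesh and SBP operators: a moving volume mesh has $n_V$ nodes, a subset of $n_S$ of which are the surface nodes. $E$ is the $n_S\times n_V$ restriction matrix from volume nodes to surface nodes (each row has a single nonzero entry, equal to $1$, distinct rows selecting distinct nodes). $\mathcal{P}\in\mathbb{R}^{n_V}$ (positive entries) and $P\in\mathbb{R}^{n_S}$ are vectors of volume and surface quadrature weights. For $i=1,\dots,p$, $\mathcal{D}_{x_i}$ are $n_V\times n_V$ matrices with the summation-by-parts (SBP) property $\mathcal{D}_{x_i}=\underline{\mathcal{P}}^{-1}\mathcal{Q}_{x_i}$, $\mathcal{Q}_{x_i}+\mathcal{Q}_{x_i}^T=E^T\underline{P}\,\underline{N}_iE$, where $N_i\in\mathbb{R}^{n_S}$ contains surface node values of the $i$-th normal component. $\dot{\boldsymbol X}_i\in\mathbb{R}^{n_V}$ contains the nodal values of the mesh velocity component $\dot x_i$, $\dot X_i=E\dot{\boldsymbol X}_i$, and $\underline{N^T\dot X}=\sum_{i=1}^p\underline{N}_i\,\underline{\dot X}_i$. Define $$\mathcal{D}_m=\tfrac12\sum_{i=1}^p\big(\underline{\dot{\boldsymbol X}}_i\mathcal{D}_{x_i}+\mathcal{D}_{x_i}\underline{\dot{\boldsymbol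 X}}_i\big).$$ Jacobian: $\mathcal{P}(t)=\underline{\mathcal{J}(t)}\,\hat{\mathcal{P}}$ where $\hat{\mathcal{P}}\in\mathbb{R}^{n_V}$ is a constant-in-time vector of (positive) reference quadrature weights and $\mathcal{J}(t)\in\mathbb{R}^{n_V}$ has strictly positive entries and satisfies $\frac{d\mathcal{J}}{dt}=\big(\underline{\boldsymbol\nabla\cdot\dot{\boldsymbol X}}\big)\mathcal{J}$, $\mathcal{J}(t_0)=\mathcal{J}_0>0$, with $\boldsymbol\nabla\cdot\dot{\boldsymbol X}\in\mathbb{R}^{n_V}$ a vector of exact or approximated nodal values of $\nabla\cdot\dot x$. Scheme: the semi-discrete scheme is $\boldsymbol U_t=\mathcal{D}(\boldsymbol U,t)\boldsymbol U+\mathcal{L}_{\boldsymbol\delta}[\mathcal{B}(\boldsymbol U,t)\boldsymbol U-G(t)]+\boldsymbol F(t)$, where $\mathcal{D}$ is $n_V\times n_V$, $\mathcal{B}$ is $n_S\times n_V$, and the lifting operator is $\mathcal{L}_{\boldsymbol\delta}=\underline{\mathcal{P}}^{-1}\boldsymbol\delta^T\underline{P}$ for an $n_S\times n_V$ matrix $\boldsymbol\delta$; here $\boldsymbol U_t=\frac{d\boldsymbol U}{dt}-\big(\mathcal{D}_m-\frac12\underline{\boldsymbol\nabla\cdot\dot{\boldsymbol X}}\big)\boldsymbol U$. With $\hat{\boldsymbol U}=\underline{\sqrt{\mathcal{J}}}\,\boldsymbol U$ this becomes $\frac{d\hat{\boldsymbol U}}{dt}=\hat{\mathcal{D}}\hat{\boldsymbol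 U}+\underline{\sqrt{\mathcal{J}}}\mathcal{L}_{\boldsymbol\delta}[\hat{\mathcal{B}}\hat{\boldsymbol U}-G]+\underline{\sqrt{\mathcal{J}}}\boldsymbol F$, where $\hat{\mathcal{D}}=\underline{\sqrt{\mathcal{J}}}\,(\mathcal{D}+\mathcal{D}_m)\,\underline{\sqrt{\mathcal{J}}}^{-1}$ and $\hat{\mathcal{B}}=\mathcal{B}\,\underline{\sqrt{\mathcal{J}}}^{-1}$. *)

(* Defs.v *)
From HB Require Import structures.
From mathcomp Require Import all_boot all_order all_algebra.
From mathcomp Require Import complex.
From mathcomp Require Import all_classical reals topology normedtype.

Set Implicit Arguments.
Unset Strict Implicit.
Unset Printing Implicit Defensive.

Import Order.TTheory GRing.Theory Num.Theory.
Import numFieldNormedType.Exports.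

Local Open Scope ring_scope.

(* Nodal vectors are column vectors, whereas [diag_mx] takes a row vector. *)
Definition Diag (R : realType) (n : nat) (v : 'cV[R]_n) : 'M[R]_n :=
  diag_mx v^T.

Definition sqrtv (R : realType) (n : nat) (v : 'cV[R]_n) : 'cV[R]_n :=
  map_mx Num.sqrt v.

Definition posv (R : realType) (n : nat) (v : 'cV[R]_n) : Prop :=
  forall k : 'I_n, 0 < v k 0.

Definition nsdmx (R : realType) (n : nat) (A : 'M[R]_n) : Prop :=
  A^T = A /\ forall x : 'cV[R]_n, (x^T *m A *m x) 0 0 <= 0.

Definition restriction_mx (R : realType) (nS nV : nat) (E : 'M[R]_(nS, nV)) :
    Prop :=
  exists2 s : 'I_nS -> 'I_nV,
    injective s & E = \matrix_(i, j) (j == s i)%:R.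

(* [f] has derivative [l] at [s] relative to the interval [[a, b]]: two-sided
   in the interior, one-sided at the endpoints. *)
Definition derivative_within (R : realType) (a b : R) (f : R -> R) (s l : R) :
    Prop :=
  ((fun r : R => (f r - f s) / (r - s)) @ within `[a, b]%classic (s^')
     --> l)%classic.

Definition sbp (R : realType) (nV nS : nat) (E : 'M[R]_(nS, nV))
    (Pv : 'cV[R]_nV) (Ps N : 'cV[R]_nS) (Dx Q : 'M[R]_nV) : Prop :=
  Dx = invmx (Diag Pv) *m Q /\ Q + Q^T = E^T *m Diag Ps *m Diag N *m E.

Definition Dmesh (R : realType) (p nV : nat) (Xdot : 'I_p -> 'cV[R]_nV)
    (Dx : 'I_p -> 'M[R]_nV) : 'M[R]_nV :=
  2^-1 *: \sum_(i < p) (Diag (Xdot i) *m Dx i + Dx i *m Diag (Xdot i)).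

(* Already in diagonal matrix form. *)
Definition normal_velocity (R : realType) (p nV nS : nat)
    (E : 'M[R]_(nS, nV)) (N : 'I_p -> 'cV[R]_nS) (Xdot : 'I_p -> 'cV[R]_nV) :
    'M[R]_nS :=
  \sum_(i < p) Diag (N i) *m Diag (E *m Xdot i).

Definition lift_mx (R : realType) (nV nS : nat) (Pv : 'cV[R]_nV)
    (Ps : 'cV[R]_nS) (delta : 'M[R]_(nS, nV)) : 'M[R]_(nV, nS) :=
  invmx (Diag Pv) *m delta^T *m Diag Ps.

Definition sys_mx (R : realType) (nV nS : nat) (D : 'M[R]_nV)
    (L : 'M[R]_(nV, nS)) (B : 'M[R]_(nS, nV)) : 'M[R]_nV :=
  D + L *m B.

Definition hatD (R : realType) (nV : nat) (J : 'cV[R]_nV)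
    (D Dm : 'M[R]_nV) : 'M[R]_nV :=
  Diag (sqrtv J) *m (D + Dm) *m invmx (Diag (sqrtv J)).

Definition hatB (R : realType) (nV nS : nat) (J : 'cV[R]_nV)
    (B : 'M[R]_(nS, nV)) : 'M[R]_(nS, nV) :=
  B *m invmx (Diag (sqrtv J)).

Definition hat_sys_mx (R : realType) (nV nS : nat) (J : 'cV[R]_nV)
    (D Dm : 'M[R]_nV) (L : 'M[R]_(nV, nS)) (B : 'M[R]_(nS, nV)) : 'M[R]_nV :=
  hatD J D Dm + Diag (sqrtv J) *m L *m hatB J B.

(* The spectrum of a real matrix is taken over the complex numbers. *)
Definition spectrum (R : realType) (n : nat) (A : 'M[R]_n) :
    set (complex R) :=
  [set lambda | eigenvalue (map_mx (real_complex R) A) lambda]%classic.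

(* Main.v *)
(** Put S = Diag(sqrt J). Since P = J Phat and diagonal matrices commute,
    P = S Phat S, and Mhat = S (M + Dm) S^-1. Conjugating the transformed
    condition by S therefore gives P (M + Dm) + (M + Dm)^T P - alpha P, and
    congruence by an invertible matrix preserves semidefiniteness. The SBP
    property, together with E Diag(x) = Diag(E x) E for a restriction matrix E, turns
    P Dm + Dm^T P into the surface term E^T P_S (N^T Xdot) E. The spectral
    bound is the Lyapunov argument: for an eigenvector z of Mhat, the real
    part of z^* Phat Mhat z is Re(lambda) z^* Phat z. *)
Require Import Defs.
From HB Require Import structures.
From mathcomp Require Import all_boot all_order all_algebra.
From mathcomp Require Import complex.
From mathcomp Require Import all_classical reals topology normedtype.
From mathcomp Require Import ring lra.

Set Implicit Arguments.
Unset Strict Implicit.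
Unset Printing Implicit Defensive.

Import Order.TTheory GRing.Theory Num.Theory.
Import numFieldNormedType.Exports.

Local Open Scope ring_scope.

(** * Diagonal matrices, their quadratic forms and restriction matrices *)

Section Diagonal.
Variable R : realType.

Lemma tr_Diag n (v : 'cV[R]_n) : (Diag v)^T = Diag v.
Proof. exact: tr_diag_mx. Qed.

Lemma Diag_mulmx n m (v : 'cV[R]_n) (A : 'M[R]_(n, m)) i j :
  (Diag v *m A) i j = v i 0 * A i j.
Proof. by rewrite mul_diag_mx !mxE. Qed.

Lemma mulmx_Diag n m (v : 'cV[R]_n) (A : 'M[R]_(m, n)) i j :
  (A *m Diag v) i j = A i j * v j 0.
Proof. by rewrite mul_mx_diag !mxE. Qed.

Lemma Diag_comm n (v w : 'cV[R]_n) : Diag v *m Diag w = Diag w *m Diag v.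
Proof. exact: diag_mxC. Qed.

Lemma Diag_mul n (v w : 'cV[R]_n) : Diag (Diag v *m w) = Diag v *m Diag w.
Proof.
apply/matrixP => i j.
rewrite [RHS]Diag_mulmx [LHS]mxE [X in X *+ _]mxE Diag_mulmx !mxE.
by rewrite mulrnAr; case: eqP => // ->.
Qed.

Lemma Diag_unitmx n (v : 'cV[R]_n) : posv v -> Diag v \in unitmx.
Proof.
move=> v_gt0; rewrite unitmxE det_diag unitfE.
by apply/prodf_neq0 => i _; rewrite mxE gt_eqF.
Qed.

Lemma posv_sqrtv n (v : 'cV[R]_n) : posv v -> posv (sqrtv v).
Proof. by move=> v_gt0 i; rewrite mxE sqrtr_gt0. Qed.

Lemma Diag_sqrtvK n (v : 'cV[R]_n) :
  posv v -> Diag (sqrtv v) *m Diag (sqrtv v) = Diag v.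
Proof.
move=> v_gt0; rewrite -Diag_mul; congr Diag.
apply/matrixP => i j.
by rewrite ord1 Diag_mulmx mxE -expr2 sqr_sqrtr // ltW.
Qed.

Lemma Diag_quadE n (v x : 'cV[R]_n) :
  (x^T *m Diag v *m x) 0 0 = \sum_k v k 0 * x k 0 ^+ 2.
Proof.
rewrite mxE; apply: eq_bigr => k _.
by rewrite mulmx_Diag mxE expr2; ring.
Qed.

Lemma Diag_quad_ge0 n (v x : 'cV[R]_n) :
  posv v -> 0 <= (x^T *m Diag v *m x) 0 0.
Proof.
move=> v_gt0; rewrite Diag_quadE.
by apply: sumr_ge0 => k _; rewrite mulr_ge0 ?sqr_ge0 ?ltW.
Qed.

Lemma Diag_quad_gt0 n (v x : 'cV[R]_n) :
  posv v -> x != 0 -> 0 < (x^T *m Diag v *m x) 0 0.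
Proof.
move=> v_gt0 x_neq0; rewrite lt_def Diag_quad_ge0 // andbT.
apply: contra_neq x_neq0; rewrite Diag_quadE => q0.
apply/matrixP => i j; rewrite ord1 [RHS]mxE; apply/eqP.
have q_ge0 k : true -> 0 <= v k 0 * x k 0 ^+ 2.
  by move=> _; rewrite mulr_ge0 ?sqr_ge0 ?ltW.
have /eqP := psumr_eq0P q_ge0 q0 (erefl : true) (i := i).
by rewrite mulf_eq0 gt_eqF //= sqrf_eq0.
Qed.

(** Row [i] of [E] is the unit row at [s i], so row [i] of either product has [x (s i)] at column
    [s i] and zeros elsewhere. *)
Lemma restriction_mx_Diag nS nV (E : 'M[R]_(nS, nV)) (x : 'cV[R]_nV) :
  restriction_mx E -> E *m Diag x = Diag (E *m x) *m E.
Proof.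
case=> s _ ->; apply/matrixP => i j; rewrite mulmx_Diag Diag_mulmx !mxE.
rewrite (bigD1 (s i)) //= big1 => [|k /negPf k_neq]; last first.
  by rewrite mxE k_neq mul0r.
by rewrite mxE eqxx mul1r addr0; case: eqP => [->|_];
  rewrite ?mulr1 ?mul1r ?mulr0 ?mul0r.
Qed.

End Diagonal.

(** * Congruence of semidefinite matrices and the Lyapunov bound on the spectrum *)

Section Semidefinite.
Variable R : realType.

(** Substituting [T *m x] for [x] gives one direction for an arbitrary [T]; the converse is the same
    fact for [invmx S], which undoes the congruence. *)
Lemma nsdmx_congr n (S A : 'M[R]_n) :
  S \in unitmx -> nsdmx (S^T *m A *m S) <-> nsdmx A.
Proof.
have congr (T C : 'M[R]_n) : nsdmx C -> nsdmx (T^T *m C *m T).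
  move=> [C_sym C_le0]; split; first by rewrite !trmx_mul trmxK C_sym mulmxA.
  by move=> x; have := C_le0 (T *m x); rewrite trmx_mul !mulmxA.
move=> S_unit; split; last exact: congr.
move=> /(congr (invmx S)).
rewrite !mulmxA -trmx_mul mulmxV // trmx1 mul1mx -mulmxA mulmxV //.
by rewrite mulmx1.
Qed.

Lemma Re_mulmx_real m n (v : 'M[complex R]_(m, n)) (A : 'M[R]_n) :
  map_mx (@complex.Re R) (v *m map_mx (real_complex R) A)
  = map_mx (@complex.Re R) v *m A.
Proof.
apply/matrixP => i j; rewrite !mxE raddf_sum; apply: eq_bigr => k _.
by rewrite !mxE; case: (v i k) => a b /=; rewrite mulr0 subr0.
Qed.

Lemma Im_mulmx_real m n (v : 'M[complex R]_(m, n)) (A : 'M[R]_n) :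
  map_mx (@complex.Im R) (v *m map_mx (real_complex R) A)
  = map_mx (@complex.Im R) v *m A.
Proof.
apply/matrixP => i j; rewrite !mxE raddf_sum; apply: eq_bigr => k _.
by rewrite !mxE; case: (v i k) => a b /=; rewrite mulr0 add0r.
Qed.

(** Splitting a complex left eigenvector into real and imaginary parts [a] and [b] lets the Lyapunov
    argument run entirely over the reals. *)
Lemma spectrum_realP n (A : 'M[R]_n) (l : complex R) : spectrum A l ->
  exists a b : 'rV[R]_n,
    [/\ a *m A = complex.Re l *: a - complex.Im l *: b,
        b *m A = complex.Re l *: b + complex.Im l *: a
      & (a != 0) || (b != 0)].
Proof.
move=> /eigenvalueP[v vA v_neq0].
exists (map_mx (@complex.Re R) v), (map_mx (@complex.Im R) v); split.
- rewrite -Re_mulmx_real vA; apply/matrixP => i j; rewrite !mxE.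
  by case: (v i j) l {vA} => [? ?] [].
- rewrite -Im_mulmx_real vA; apply/matrixP => i j; rewrite !mxE.
  by case: (v i j) l {vA} => [? ?] [].
rewrite -negb_and; apply: contra_neqN v_neq0 => /andP[/eqP a0 /eqP b0].
apply/matrixP => i j; move/matrixP/(_ i j): b0; move/matrixP/(_ i j): a0.
by rewrite !mxE; case: (v i j) => ? ? /= -> ->.
Qed.

(** With [W x = a^T] and [W y = b^T], adding the forms of [W A] at [x] and [y] gives
    [Re l * (a x + b y)]: the terms in [Im l] cancel because [a y = b x]. The sum is nonpositive,
    while [a x + b y] is positive. *)
Lemma lyapunov_spectrum_Re_le0 n (w : 'cV[R]_n) (A : 'M[R]_n) :
  posv w -> nsdmx (Diag w *m A + A^T *m Diag w) ->
  forall l, spectrum A l -> complex.Re l <= 0.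
Proof.
move=> w_gt0 [_ A_le0] l /spectrum_realP[a [b [aA bA ab_neq0]]].
set W := Diag w in A_le0.
have W_unit : W \in unitmx by exact: Diag_unitmx.
(* [eigenvalue] refers to left eigenvectors, so the quadratic form is
   evaluated at [(a + i b) W^-1] *)
pose x := (a *m invmx W)^T; pose y := (b *m invmx W)^T.
have xW : x^T *m W = a by rewrite trmxK mulmxKV.
have yW : y^T *m W = b by rewrite trmxK mulmxKV.
clearbody x y.
have quadE (z : 'cV[R]_n) :
    (z^T *m (W *m A + A^T *m W) *m z) 0 0 = (z^T *m W *m A *m z) 0 0 *+ 2.
  (* The two summands are transposes of each other, hence equal as scalars. *)
  rewrite mulmxDr mulmxDl mxE mulr2n !mulmxA; congr (_ + _).
  transitivity ((z^T *m W *m A *m z)^T 0 0); last by rewrite mxE.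
  by rewrite !trmx_mul trmxK tr_Diag !mulmxA.
have := A_le0 x; have := A_le0 y.
rewrite !quadE !pmulrn_lle0 // xW yW aA bA => y_le0 x_le0.
(* Both sides are the bilinear form of the symmetric [W] at [x] and [y]. *)
have aybx : (a *m y) 0 0 = (b *m x) 0 0.
  transitivity ((b *m x)^T 0 0); last by rewrite mxE.
  by rewrite -xW -yW !trmx_mul tr_Diag trmxK mulmxA.
have sum_gt0 : 0 < (a *m x) 0 0 + (b *m y) 0 0.
  rewrite -xW -yW; case/orP: ab_neq0 => c_neq0.
    rewrite ltr_pwDl ?Diag_quad_ge0 // Diag_quad_gt0 //.
    by apply: contra_neq c_neq0; rewrite -xW => ->; rewrite trmx0 mul0mx.
  rewrite ltr_wpDl ?Diag_quad_ge0 // Diag_quad_gt0 //.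
  by apply: contra_neq c_neq0; rewrite -yW => ->; rewrite trmx0 mul0mx.
rewrite -(pmulr_lle0 _ sum_gt0).
have linE (r s : R) (c d : 'rV[R]_n) (z : 'cV[R]_n) :
    ((r *: c + s *: d) *m z) 0 0 = r * (c *m z) 0 0 + s * (d *m z) 0 0.
  by rewrite mulmxDl -!scalemxAl !mxE.
move: x_le0 y_le0; rewrite -scaleNr !linE aybx.
by move=> x_le0 y_le0; lra.
Qed.

End Semidefinite.

(** * The surface term of the mesh motion and the change of variables by the Jacobian *)

Section MeshMotion.
Variable R : realType.

(** Since [Diag Pv] commutes with [X], each direction contributes half of
    [X (Q + Q^T) + (Q + Q^T) X]. By SBP both products equal the same surface matrix, which absorbs
    the factor one half. *)
Lemma Dmesh_sbp p nV nS (E : 'M[R]_(nS, nV)) (Pv : 'cV[R]_nV)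
    (Ps : 'cV[R]_nS) (N : 'I_p -> 'cV[R]_nS) (Dx Q : 'I_p -> 'M[R]_nV)
    (Xdot : 'I_p -> 'cV[R]_nV) :
  restriction_mx E -> posv Pv ->
  (forall i, sbp E Pv Ps (N i) (Dx i) (Q i)) ->
  Diag Pv *m Dmesh Xdot Dx + (Dmesh Xdot Dx)^T *m Diag Pv
  = E^T *m Diag Ps *m normal_velocity E N Xdot *m E.
Proof.
move=> E_restr Pv_pos Dx_sbp.
have PDx i : Diag Pv *m Dx i = Q i.
  by have [-> _] := Dx_sbp i; rewrite mulKVmx // Diag_unitmx.
have DxP i : (Dx i)^T *m Diag Pv = (Q i)^T.
  by rewrite -PDx trmx_mul tr_Diag.
rewrite /Dmesh /normal_velocity [(_ *: _)^T]linearZ /=.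
rewrite -scalemxAr -scalemxAl -scalerDr.
rewrite [(\sum_(_ < _) _)^T]linear_sum /= mulmx_sumr mulmx_suml -big_split /=.
rewrite mulmx_sumr mulmx_suml scaler_sumr; apply: eq_bigr => i _.
set X := Diag (Xdot i).
have QX : (Q i + (Q i)^T) *m X
    = E^T *m Diag Ps *m (Diag (N i) *m Diag (E *m Xdot i)) *m E.
  have [_ ->] := Dx_sbp i.
  by rewrite -!mulmxA restriction_mx_Diag.
(* Transposition swaps the two products, and the surface form of [QX] is symmetric because its
   diagonal factors commute. *)
have XQ : X *m (Q i + (Q i)^T) = (Q i + (Q i)^T) *m X.
  transitivity (((Q i + (Q i)^T) *m X)^T).
    by rewrite trmx_mul tr_Diag [(_ + _)^T]linearD /= trmxK addrC.
  rewrite QX !trmx_mul trmxK !tr_Diag !mulmxA.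
  congr (_ *m E); rewrite -!mulmxA; congr (_ *m _).
  rewrite (Diag_comm (N i) Ps) [LHS]mulmxA (Diag_comm _ Ps) -mulmxA.
  by rewrite (Diag_comm _ (N i)).
transitivity (2^-1 *: (X *m (Q i + (Q i)^T) + (Q i + (Q i)^T) *m X)).
  have PX : Diag Pv *m X = X *m Diag Pv by exact: Diag_comm.
  congr (_ *: _); rewrite [(_ + _)^T]linearD /= !trmx_mul tr_Diag -/X.
  rewrite !mulmxDr !mulmxDl !mulmxA PX PDx -!mulmxA -PX PDx DxP !mulmxA DxP.
  by rewrite [(Q i)^T *m X + _]addrC addrACA.
rewrite XQ -QX -mulr2n -[_ *m X *+ 2]scaler_nat scalerA.
by rewrite mulVf ?scale1r ?pnatr_eq0.
Qed.

(** The scaling by [sqrt J] is a similarity acting on volume and lifting terms alike, so it factors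
    out of their sum. *)
Lemma hat_sys_mxE nV nS (J : 'cV[R]_nV) (D Dm : 'M[R]_nV)
    (L : 'M[R]_(nV, nS)) (B : 'M[R]_(nS, nV)) :
  hat_sys_mx J D Dm L B
  = Diag (sqrtv J) *m (sys_mx D L B + Dm) *m invmx (Diag (sqrtv J)).
Proof.
rewrite /hat_sys_mx /hatD /hatB /sys_mx mulmxA -mulmxDl; congr (_ *m _).
by rewrite -mulmxA -mulmxDr addrAC.
Qed.

(** The outer factors [S] cancel the [S^-1] in [Ahat] and its transpose; those left over combine
    with [Diag w] into [W = S Diag(w) S]. With [v = J] and [w = Phat], [W] is the matrix of the
    physical weights. *)
Lemma Diag_hat_congr n (w v : 'cV[R]_n) (A : 'M[R]_n) (alpha : R) :
  posv v ->
  let S := Diag (sqrtv v) in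
  let Ahat := S *m A *m invmx S in
  let W := Diag (Diag v *m w) in
  S^T *m (Diag w *m Ahat + Ahat^T *m Diag w - alpha *: Diag w) *m S
  = W *m A + A^T *m W - alpha *: W.
Proof.
move=> v_gt0 S Ahat W.
have S_unit : S \in unitmx by apply/Diag_unitmx/posv_sqrtv.
have S_sym : S^T = S by exact: tr_Diag.
have WE : W = S *m Diag w *m S.
  by rewrite /W Diag_mul -Diag_sqrtvK // -!mulmxA (Diag_comm w).
have AhatS : Ahat *m S = S *m A by rewrite mulmxKV.
have SAhat : S *m Ahat^T = A^T *m S.
  by rewrite -[in LHS]S_sym -trmx_mul AhatS trmx_mul S_sym.
clearbody Ahat W S.
rewrite S_sym mulmxBr mulmxBl mulmxDr mulmxDl -scalemxAr -scalemxAl.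
by rewrite !mulmxA SAhat -!mulmxA AhatS !mulmxA -!mulmxA WE !mulmxA.
Qed.

End MeshMotion.

Theorem proposition3p6 (R : realType) (p nV nS : nat)
    (t0 T : R)
    (E : R -> 'M[R]_(nS, nV))
    (Pv : R -> 'cV[R]_nV) (Ps : R -> 'cV[R]_nS)
    (N : 'I_p -> R -> 'cV[R]_nS)
    (Dx Q : 'I_p -> R -> 'M[R]_nV)
    (Xdot : 'I_p -> R -> 'cV[R]_nV)
    (Phat : 'cV[R]_nV) (J : R -> 'cV[R]_nV) (J0 : 'cV[R]_nV)
    (divX : R -> 'cV[R]_nV)
    (D : 'cV[R]_nV -> R -> 'M[R]_nV)
    (B : 'cV[R]_nV -> R -> 'M[R]_(nS, nV))
    (delta : R -> 'M[R]_(nS, nV))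
    (E_restr : forall s, s \in `[t0, T] -> restriction_mx (E s))
    (Pv_pos : forall s, s \in `[t0, T] -> posv (Pv s))
    (Dx_sbp : forall s, s \in `[t0, T] -> forall i : 'I_p,
       sbp (E s) (Pv s) (Ps s) (N i s) (Dx i s) (Q i s))
    (Phat_pos : posv Phat)
    (PvE : forall s, s \in `[t0, T] -> Pv s = Diag (J s) *m Phat)
    (J_pos : forall s, s \in `[t0, T] -> posv (J s))
    (J_ode : forall s, s \in `[t0, T] -> forall k : 'I_nV,
       derivative_within t0 T (fun r => J r k 0) s
         ((Diag (divX s) *m J s) k 0))
    (J_init : J t0 = J0) (J0_pos : posv J0)
    (alpha : R) (t : R) (t_in : t \in `[t0, T]) (U : 'cV[R]_nV) :
  let L := lift_mx (Pv t) (Ps t) (delta t) in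
  let Dm := Dmesh (fun i => Xdot i t) (fun i => Dx i t) in
  let NX := normal_velocity (E t) (fun i => N i t) (fun i => Xdot i t) in
  let M := sys_mx (D U t) L (B U t) in
  let Mhat := hat_sys_mx (J t) (D U t) Dm L (B U t) in
  (nsdmx (Diag (Pv t) *m M + M^T *m Diag (Pv t)
          + (E t)^T *m Diag (Ps t) *m NX *m E t - alpha *: Diag (Pv t))
   <->
   nsdmx (Diag Phat *m Mhat + Mhat^T *m Diag Phat - alpha *: Diag Phat))
  /\
  (alpha <= 0 ->
   nsdmx (Diag Phat *m Mhat + Mhat^T *m Diag Phat - alpha *: Diag Phat) ->
   forall lambda : complex R, spectrum Mhat lambda -> complex.Re lambda <= 0).
Proof.
move=> L Dm NX M Mhat; split; last first.
  move=> alpha_le0 [Mhat_sym Mhat_le0].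
  apply: (lyapunov_spectrum_Re_le0 Phat_pos); split.
    by rewrite [(_ + _)^T]linearD /= !trmx_mul trmxK tr_Diag addrC.
  move=> x; have := Mhat_le0 x.
  have -> (A : 'M[R]_nV) : (x^T *m (A - alpha *: Diag Phat) *m x) 0 0
      = (x^T *m A *m x) 0 0 - alpha * (x^T *m Diag Phat *m x) 0 0.
    by rewrite mulmxBr mulmxBl -scalemxAr -scalemxAl !mxE.
  (* The form of the symmetrized part is at most [alpha] times that of [Diag Phat], which is
     nonpositive for [alpha <= 0]. *)
  rewrite subr_le0 => /le_trans; apply.
  by rewrite mulr_le0_ge0 ?Diag_quad_ge0.
have S_unit := Diag_unitmx (posv_sqrtv (J_pos _ t_in)).
have hatE := Diag_hat_congr Phat (M + Dm) alpha (J_pos _ t_in).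
rewrite /= -PvE // in hatE.
apply: (iff_trans _ (nsdmx_congr _ S_unit)).
rewrite /Mhat hat_sys_mxE hatE.
(* After the congruence both conditions carry the same [alpha] term; they differ only in that [Dm]
   stands in place of the surface term. *)
suff -> : Diag (Pv t) *m (M + Dm) + (M + Dm)^T *m Diag (Pv t)
    = Diag (Pv t) *m M + M^T *m Diag (Pv t)
      + (E t)^T *m Diag (Ps t) *m NX *m E t by [].
rewrite -(Dmesh_sbp (fun i => Xdot i t) (E_restr _ t_in) (Pv_pos _ t_in)
  (Dx_sbp _ t_in)).
by rewrite [(_ + _)^T]linearD /= mulmxDr mulmxDl addrACA.
Qed.
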